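(* Fix $\kappa>1$. There are constants $a_\kappa,c_\kappa>0$ such that the following holds. If $1-\delta_{\mathrm{TV}}=2^{-ad}$ with $0<a\le a_\kappa$, then every finite-bit sampler using a transcript of at most $Q$ bits and satisfying \[ \sup_{\pi\in\mathcal C_d(\kappa)} d_{\mathrm{TV}}\bigl(\mathcal L(\widehat Y),\pi\bigr)\le\delta_{\mathrm{TV}} \] must have $Q\ge c_\kappa d$, for all sufficiently large $d$.
   Context: $\mathcal C_d(\kappa)=\{\mathcal N(0,\Sigma):\frac1\kappa I\preceq\Sigma\preceq I\}$ on $\mathbb R^d$. A finite-bit sampler with transcript of at most $Q$ bits: when the target is $\pi\in\mathcal C_d(\kappa)$, there is common randomness $Z$ independent of $\pi$, a transcript $T=T(\pi,Z)$ in a fixed set of size at most $2^Q$, and output $\widehat Y=\widehat Y(T,Z)$; $\mathcal L(\widehat Y)$ is its law when the target is $\pi$, and $d_{\mathrm{TV}}$ is total variation distance. *)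

(* Defs.v *)
From mathcomp Require Import all_boot all_order all_algebra.
From mathcomp Require Import all_classical all_reals all_analysis.

Set Implicit Arguments.
Unset Strict Implicit.
Unset Printing Implicit Defensive.

Import Order.TTheory GRing.Theory Num.Theory.

Local Open Scope classical_set_scope.
Local Open Scope ring_scope.

(* R^d carries the product sigma-algebra of the Borel sets of R, that is, its
   Borel sigma-algebra. *)
Notation rspace R d := (d.-tuple (measurableTypeR R)).

(* The product measure of [lebesgue_measure] with itself d times, through the
   identification of R * R^n with R^n.+1. *)
Fixpoint lebesgue_rspace (R : realType) (d : nat) : set (rspace R d) -> \bar R :=
  match d return set (rspace R d) -> \bar R with
  | 0 => dirac ([tuple] : rspace R 0)
  | n.+1 => pushforward (lebesgue_measure \x @lebesgue_rspace R n)%E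
      (fun p : measurableTypeR R * rspace R n =>
         [tuple of p.1 :: p.2] : rspace R n.+1)
  end.

Section gaussian.
Variables (R : realType) (d : nat).
Implicit Types A B S : 'M[R]_d.

Definition psdmx A :=
  A^T = A /\ forall v : 'rV[R]_d, 0 <= (v *m A *m v^T) 0 0.

Definition loewner_le A B := psdmx (B - A).

(* Density of N(0, S) for a positive definite S. *)
Definition gaussian_pdf S (x : rspace R d) : R :=
  let v := \row_i tnth x i in
  expR (- (v *m invmx S *m v^T) 0 0 / 2) / Num.sqrt ((2 * pi) ^+ d * \det S).

Definition is_gaussian S (mu : probability (rspace R d) R) :=
  forall A : set (rspace R d), measurable A ->
    mu A = (\int[@lebesgue_rspace R d]_(x in A) (gaussian_pdf S x)%:E)%E.

(* Since 0 < 1 / kappa, every covariance matrix below is positive definite, so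
   that N(0, S) has density [gaussian_pdf S]. *)
Definition gaussian_class (kappa : R) : set (probability (rspace R d) R) :=
  [set mu | exists S : 'M[R]_d,
    [/\ S^T = S, loewner_le (kappa^-1)%:M S, loewner_le S 1%:M
      & is_gaussian S mu]].

End gaussian.

Definition tv_dist (R : realType) (dX : measure_display)
    (X : measurableType dX) (mu nu : set X -> \bar R) : \bar R :=
  ereal_sup [set `|mu A - nu A|%E | A in [set A : set X | measurable A]].

(* The common randomness z has law P, which does not depend on the target; all
   the randomness used by the encoder and by the decoder is part of z. *)
Record sampler (R : realType) (dX : measure_display) (X : measurableType dX)
    (C : set (probability X R)) (dZ : measure_display)
    (Z : measurableType dZ) (P : probability Z R) (T : finType) := Sampler {
  transcript : probability X R -> Z -> T ;
  output : T -> Z -> X ;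
  measurable_transcript : forall (mu : probability X R) (t : T), C mu ->
    measurable [set z | transcript mu z = t] ;
  measurable_output : forall t : T, measurable_fun setT (output t)
}.

Definition output_law (R : realType) (dX : measure_display)
    (X : measurableType dX) (C : set (probability X R)) (dZ : measure_display)
    (Z : measurableType dZ) (P : probability Z R) (T : finType)
    (s : sampler C P T) (mu : probability X R) : set X -> \bar R :=
  pushforward P (fun z => output s (transcript s mu z) z).

(* Main.v *)
Require Import Defs.
From HB Require Import structures.
From mathcomp Require Import all_boot all_order all_algebra.
From mathcomp Require Import all_classical all_reals all_analysis.
From mathcomp Require Import measurable_realfun ring lra.

(* For b in {0,1}^d let mu_b be the centered Gaussian with diagonal covariance
   whose i-th entry is 1 if b_i = 1 and t^2 = 1 / kappa if b_i = 0. Let g_1 and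
   g_0 be the two one-dimensional densities, h = sqrt (g_1 g_0), B < 1 the
   integral of h (Bhattacharyya coefficient), and r = sqrt ((1 + B) / 2) < 1.
   The weights v_b = (g_b + h) / (2 r g_b) satisfy int g_b v_b = r and
   1 / v_1 + 1 / v_0 = 2 r. Hence, for the events
   A_b = {x | prod_i v_(b_i) (x_i) <= 1}, Markov's inequality gives
   mu_b (~ A_b) <= r^d, whereas every point lies in at most (2 r)^d of the A_b.
   Conditionally on the common randomness a sampler has at most |T| possible
   outputs, so that, summing P (output for mu_b lies in A_b) >= 1 - delta - r^d
   over the 2^d words b, 2^d (1 - delta - r^d) <= |T| (2 r)^d, that is,
   1 - delta <= (|T| + 1) r^d. *)

Set Implicit Arguments.
Unset Strict Implicit.
Unset Printing Implicit Defensive.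

Import Order.TTheory GRing.Theory Num.Theory.

Local Open Scope classical_set_scope.
Local Open Scope ring_scope.

(** * Lebesgue measure on R^d: sigma-finiteness, Tonelli, integrals of products *)

Lemma sigma_finite_measure_of d (T : measurableType d) (R : realType)
    (m : {measure set T -> \bar R}) : sigma_finite setT m ->
  {m' : {sigma_finite_measure set T -> \bar R} | forall A, m' A = m A}.
Proof.
move=> m_sf.
pose H1 := @isSFinite.Build d T R m (sfinite_measure_sigma_finite m_sf).
pose H2 := @isSigmaFinite.Build d T R m m_sf.
by exists (HB.pack_for (SigmaFiniteMeasure.type T R) (Measure.sort m) H1 H2).
Qed.

Section lebesgue_rspace_measure.
Variable R : realType.

Definition rspace_cons n (p : measurableTypeR R * rspace R n) : rspace R n.+1 :=
  [tuple of p.1 :: p.2].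

Lemma measurable_rspace_cons n : measurable_fun setT (@rspace_cons n).
Proof. exact: measurable_cons. Qed.

Lemma measurable_rspace_uncons n : measurable_fun setT
  (fun x : rspace R n.+1 => (thead x, [tuple of behead x] : rspace R n)).
Proof.
apply: measurable_fun_pair; first exact: measurable_tnth.
exact: measurable_behead.
Qed.

(** [lebesgue_rspace] is a bare set function, while integration and Tonelli need a bundled
    sigma-finite measure. Induction on [d] follows the recursion: a pushforward of a product measure
    is a measure, and boxes of finite measure exhaust the space. *)
Lemma lebesgue_rspace_measure d :
  {m : {sigma_finite_measure set (rspace R d) -> \bar R} |
    forall A, m A = lebesgue_rspace A}.
Proof.
elim: d => [|n [m mE]].
  by exists (dirac ([tuple] : rspace R 0)).
have mE' : m = @lebesgue_rspace R n :> (_ -> _) by exact/funext.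
pose leb : {sigma_finite_measure set (measurableTypeR R) -> \bar R} :=
  lebesgue_measure.
pose lm : {measure set (measurableTypeR R * rspace R n)%type -> \bar R} :=
  (leb \x m)%E.
pose p : {measure set (rspace R n.+1) -> \bar R} :=
  measure_function_pushforward__canonical__measure_function_Measure
    lm (@measurable_rspace_cons n).
have sf : sigma_finite setT p.
  have /sigma_finiteP[F [FT ndF Foo]] := sigma_finiteT leb.
  have /sigma_finiteP[G [GT ndG Goo]] := sigma_finiteT m.
  (* Both exhaustions are increasing, so a point with head in [F j] and tail in [G k] lies in the
     box of index [maxn j k]; a single index suffices. *)
  exists (fun i => [set x : rspace R n.+1 |
      F i (thead x) /\ G i [tuple of behead x]]).
    apply/esym; rewrite -subTset => x _.
    have [[j _ Fj] [k _ Gk]] : (\bigcup_i F i) (thead x) /\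
        (\bigcup_i G i) [tuple of behead x] by rewrite -FT -GT.
    exists (maxn j k) => //; split.
      exact: (subsetPset _ _ (ndF _ _ (leq_maxl j k))).
    exact: (subsetPset _ _ (ndG _ _ (leq_maxr j k))).
  move=> i; have [mF Flt] := Foo i; have [mG Glt] := Goo i; split.
    rewrite -[X in measurable X]setTI.
    exact: (measurable_rspace_uncons measurableT (measurableX mF mG)).
  rewrite (_ : p _ = lm (F i `*` G i)).
    by rewrite /lm /= product_measure1E// lte_mul_pinfty// ge0_fin_numE.
  congr (lm _); apply/seteqP; split => -[x y] /=; rewrite theadE.
    by move=> [Fx Gy]; split=> //; congr (G i _): Gy; exact/val_inj.
  by move=> [Fx Gy]; split=> //; congr (G i _): Gy; exact/val_inj.
have [m' m'E] := sigma_finite_measure_of sf.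
by exists m' => A; rewrite m'E /= -mE'.
Qed.

(** Change of variables along [rspace_cons], then Tonelli for the nonnegative integrand. *)
Lemma integral_rspace_cons n (F : rspace R n.+1 -> \bar R) :
  measurable_fun setT F -> (forall x, 0 <= F x)%E ->
  (\int[@lebesgue_rspace R n.+1]_x F x =
   \int[lebesgue_measure]_x
     \int[@lebesgue_rspace R n]_y F (rspace_cons (x, y)))%E.
Proof.
move=> mF F0; have [m mE] := lebesgue_rspace_measure n.
have {}mE : @lebesgue_rspace R n = m :> (_ -> _) by exact/funext.
pose leb : {sigma_finite_measure set (measurableTypeR R) -> \bar R} :=
  lebesgue_measure.
pose lm : {measure set (measurableTypeR R * rspace R n)%type -> \bar R} :=
  (leb \x m)%E.
rewrite mE -(fubini_tonelli1 (m1 := leb) (m2 := m) (F \o @rspace_cons n))//.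
- have := @ge0_integral_pushforward _ _ _ _ R _
    (@measurable_rspace_cons n) lm setT F.
  by rewrite preimage_setT /= mE; apply.
- exact: measurableT_comp (@measurable_rspace_cons n).
- by move=> x; exact: F0.
Qed.

Lemma measurable_prod_tnth d (f : 'I_d -> R -> R) :
  (forall i, measurable_fun setT (f i)) ->
  measurable_fun setT (fun x : rspace R d => \prod_i f i (tnth x i)).
Proof.
move=> mf; apply: measurable_prod => i _.
exact: (measurableT_comp (mf i) (measurable_tnth i)).
Qed.

Lemma integral_rspace_prod d (f : 'I_d -> R -> R) (I : 'I_d -> R) :
  (forall i, measurable_fun setT (f i)) -> (forall i x, 0 <= f i x) ->
  (forall i, \int[lebesgue_measure]_x (f i x)%:E = (I i)%:E)%E ->
  (\int[@lebesgue_rspace R d]_x (\prod_i f i (tnth x i))%:E =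
   (\prod_i I i)%:E)%E.
Proof.
elim: d f I => [|n IH] f I mf f0 fI.
  rewrite integral_dirac//=; last first.
    by apply/measurable_EFinP; exact: measurable_prod_tnth mf.
  by rewrite diracT mul1e !big_ord0.
have P0 k (g : 'I_k -> R -> R) (x : rspace R k) :
  (forall i x, 0 <= g i x) -> (0 <= (\prod_i g i (tnth x i))%:E)%E.
  by move=> g0; rewrite lee_fin prodr_ge0.
rewrite integral_rspace_cons//; last 2 first.
- by apply/measurable_EFinP; exact: measurable_prod_tnth mf.
- by move=> x; exact: P0.
pose g i := f (lift ord0 i).
have mg : measurable_fun setT
    (fun y : rspace R n => (\prod_i g i (tnth y i))%:E).
  by apply/measurable_EFinP; apply: measurable_prod_tnth => i; exact: mf.
(* For a fixed head, its factor leaves the inner integral, and the induction hypothesis evaluates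
   what remains to a constant. *)
transitivity (\int[lebesgue_measure]_x
    ((f ord0 x)%:E * (\prod_i I (lift ord0 i))%:E))%E.
  apply: eq_integral => x _.
  rewrite -(IH g)//; [|by move=> i; exact: mf|by move=> i; exact: f0
    |by move=> i; exact: fI].
  have [m mE] := lebesgue_rspace_measure n.
  have {}mE : @lebesgue_rspace R n = m :> (_ -> _) by exact/funext.
  rewrite mE -ge0_integralZl//; last 2 first.
  - by move=> y _; apply: P0 => i; exact: f0.
  - by rewrite lee_fin.
  apply: eq_integral => y _; rewrite -EFinM big_ord_recl; congr (_ * _)%:E.
  by apply: eq_bigr => i _; rewrite /g tnthS.
rewrite ge0_integralZr//; last 3 first.
- by apply/measurable_EFinP; exact: mf.
- by move=> x _; rewrite lee_fin.
- rewrite lee_fin prodr_ge0// => i _; rewrite -lee_fin -fI.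
  by apply: integral_ge0 => x _; rewrite lee_fin.
by rewrite fI big_ord_recl EFinM.
Qed.

End lebesgue_rspace_measure.

(** * Centered Gaussians with diagonal covariance, as members of the class *)

Lemma probability_of_density dT (T : measurableType dT) (R : realType)
    (m : {measure set T -> \bar R}) (f : T -> R) :
  measurable_fun setT f -> (forall x, 0 <= f x) ->
  (\int[m]_x (f x)%:E = 1)%E ->
  {mu : probability T R | forall A, mu A = (\int[m]_(x in A) (f x)%:E)%E}.
Proof.
move=> mf f0 f1.
pose p (A : set T) : \bar R := (\int[m]_(x in A) (f x)%:E)%E.
have p0 : p set0 = 0%E by exact: integral_set0.
have p_ge0 A : (0 <= p A)%E by apply: integral_ge0 => x _; rewrite lee_fin.
have p_sadd : semi_sigma_additive p.
  move=> F mF tF mUF.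
  rewrite {2}/p ge0_integral_bigcup//; last 2 first.
  - by apply/measurable_EFinP; exact: measurable_funTS.
  - by move=> x _; rewrite lee_fin.
  by apply: is_cvg_nneseries => n _ _; exact: p_ge0.
pose H1 := isMeasure.Build _ _ _ p p0 p_ge0 p_sadd.
pose pm : {measure set T -> \bar R} := HB.pack_for (Measure.type T R) p H1.
pose H2 := Measure_isProbability.Build _ _ _ pm f1.
by exists (HB.pack_for (Probability.type T R) (Measure.sort pm) H2).
Qed.

Section diagonal_gaussian.
Variables (R : realType) (d : nat) (sigma : 'I_d -> R).
Hypothesis sigma_gt0 : forall i, 0 < sigma i.

Definition diag_cov : 'M[R]_d := diag_mx (\row_i sigma i ^+ 2).

Lemma quad_diag_mx (v D : 'rV[R]_d) :
  (v *m diag_mx D *m v^T) 0 0 = \sum_i D 0 i * v 0 i ^+ 2.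
Proof.
rewrite mul_mx_diag mxE; apply: eq_bigr => i _; rewrite !mxE; ring.
Qed.

Lemma invmx_diag_cov : invmx diag_cov = diag_mx (\row_i (sigma i ^+ 2)^-1).
Proof.
have E : diag_cov *m diag_mx (\row_i (sigma i ^+ 2)^-1) = 1%:M.
  rewrite mulmx_diag -diag_const_mx; congr diag_mx; apply/rowP => i.
  by rewrite !mxE divff// expf_neq0// gt_eqF.
by rewrite -[RHS](mulKmx (mulmx1_unit E).1) E mulmx1.
Qed.

Lemma gaussian_pdf_diag_cov (x : rspace R d) :
  gaussian_pdf diag_cov x = \prod_i normal_pdf 0 (sigma i) (tnth x i).
Proof.
rewrite /gaussian_pdf invmx_diag_cov quad_diag_mx det_diag.
rewrite [RHS](eq_bigr (fun i => normal_fun 0 (sigma i) (tnth x i) *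
    normal_peak (sigma i))); last first.
  by move=> i _; rewrite normal_pdfE ?gt_eqF// mulrC.
rewrite big_split /=; congr (_ * _).
  rewrite -expR_sum; congr expR.
  rewrite mulNr -mulrN mulr_suml -?sumrN; apply: eq_bigr => i _.
  rewrite !mxE subr0; field.
  by rewrite gt_eqF.
rewrite /normal_peak prodfV; congr (_^-1).
(* Reading the exponent [d] as the cardinality of ['I_d] turns the power of 2 pi into a product, so
   the square root splits coordinate by coordinate. *)
rewrite -[d in _ ^+ d]card_ord -prodr_const -big_split /=.
rewrite [X in Num.sqrt X](eq_bigr (fun i => sigma i ^+ 2 * pi *+ 2));
  last first.
  by move=> i _; rewrite mxE -mulr_natl; ring.
elim/big_rec2: _ => [|i y1 y2 _ <-]; first exact: sqrtr1.
by rewrite sqrtrM// mulrn_wge0// mulr_ge0 ?sqr_ge0 ?pi_ge0.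
Qed.

Lemma is_gaussian_diag_cov :
  exists mu : probability (rspace R d) R, is_gaussian diag_cov mu.
Proof.
have [m mE] := @lebesgue_rspace_measure R d.
have {}mE : m = @lebesgue_rspace R d :> (_ -> _) by exact/funext.
pose f (x : rspace R d) := \prod_i normal_pdf 0 (sigma i) (tnth x i).
have mf : measurable_fun setT f.
  apply: (@measurable_prod_tnth R d (fun i => normal_pdf 0 (sigma i))) => i.
  exact: measurable_normal_pdf.
have f0 x : 0 <= f x.
  apply: prodr_ge0 => i _. exact: normal_pdf_ge0.
have f1 : (\int[m]_x (f x)%:E = 1)%E.
  rewrite mE (@integral_rspace_prod R d
    (fun i => normal_pdf 0 (sigma i)) (fun=> 1))//.
  - by rewrite big1.
  - by move=> i; exact: measurable_normal_pdf.
  - by move=> i x; exact: normal_pdf_ge0.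
  - by move=> i; exact: integral_normal_pdf.
have [mu muE] := probability_of_density mf f0 f1.
exists mu => A mA; rewrite muE -mE; apply: eq_integral => x _.
by rewrite gaussian_pdf_diag_cov.
Qed.

Lemma psdmx_diag_mx (D : 'rV[R]_d) :
  (forall i, 0 <= D 0 i) -> psdmx (diag_mx D).
Proof.
move=> D0; split=> [|v]; first exact: tr_diag_mx.
by rewrite quad_diag_mx sumr_ge0// => i _; rewrite mulr_ge0 ?sqr_ge0.
Qed.

Lemma gaussian_class_diag_cov (kappa : R) (mu : probability (rspace R d) R) :
  (forall i, kappa^-1 <= sigma i ^+ 2 <= 1) -> is_gaussian diag_cov mu ->
  gaussian_class kappa mu.
Proof.
move=> sigma_le muG; exists diag_cov; split=> //.
- exact: tr_diag_mx.
- rewrite /loewner_le -diag_const_mx -linearB; apply: psdmx_diag_mx => i.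
  by rewrite !mxE subr_ge0; have /andP[] := sigma_le i.
- rewrite /loewner_le -diag_const_mx -linearB; apply: psdmx_diag_mx => i.
  by rewrite !mxE subr_ge0; have /andP[] := sigma_le i.
Qed.

End diagonal_gaussian.

(** * Counting the sets hit by a sampler with few transcripts *)

Section counting.
Local Open Scope ereal_scope.

(** For fixed [z], whatever the target, the output is one of the points [output s t z], and each of
    these lies in at most [K] of the sets [A i]. Both sides bound the sum over [i] of the
    probability that the output for [mu i] falls in [A i]. *)
Lemma sampler_counting_bound (R : realType) (dX : measure_display)
    (X : measurableType dX) (C : set (probability X R)) (dZ : measure_display)
    (Z : measurableType dZ) (P : probability Z R) (T : finType)
    (s : sampler C P T) (I : finType) (mu : I -> probability X R)
    (A : I -> set X) (delta eps K : R) :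
  (forall i, C (mu i)) -> (forall i, measurable (A i)) ->
  (forall i, mu i (~` A i) <= eps%:E) ->
  (forall x, \sum_i \1_(A i) x <= K)%R ->
  (forall i, tv_dist (output_law s (mu i)) (mu i) <= delta%:E) ->
  (#|I|%:R * (1 - delta - eps) <= #|T|%:R * K)%R.
Proof.
move=> Cmu mA muA AK tvd.
pose E i := [set z | A i (output s (transcript s (mu i) z) z)].
(* Measurability of the transcript is known fibre by fibre and that of the output for each fixed
   transcript, so [E i] is split by transcript value. *)
have EE i : E i = \big[setU/set0]_t
    ([set z | transcript s (mu i) z = t] `&` (output s t @^-1` A i)).
  rewrite -bigcup_seq; apply/seteqP; split=> z /=.
    by move=> Ez; exists (transcript s (mu i) z) => //=; rewrite mem_index_enum.
  by move=> [t _ [/= <-]].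
have mE i : measurable (E i).
  rewrite EE; apply: bigsetU_measurable => t _; apply: measurableI.
    exact: measurable_transcript.
  by rewrite -[X in measurable X]setTI; exact: measurable_output.
have PE i : (1 - delta - eps)%:E <= P (E i).
  have : `|P (E i) - mu i (A i)| <= delta%:E.
    apply: le_trans (tvd i); apply: ereal_sup_ubound.
    by exists (A i); first exact: mA.
  have := muA i; rewrite probability_setC//.
  rewrite -(fineK (fin_num_measure P _ (mE i))).
  rewrite -(fineK (fin_num_measure (mu i) _ (mA i))).
  rewrite -!EFinB abse_EFin !lee_fin ler_norml => + /andP[+ _].
  by lra.
have sumE : \sum_i P (E i) <= (#|T|%:R * K)%:E.
  rewrite (eq_bigr (fun i => \int[P]_z (\1_(E i) z)%:E)); last first.
    by move=> i _; rewrite integral_indic// setIT.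
  rewrite -ge0_integral_sum//; last first.
    by move=> i; apply/measurable_EFinP; exact: measurable_indic.
  rewrite -[leRHS]mule1 -(@probability_setT _ _ _ P) -integral_cst//.
  apply: ge0_le_integral => //.
  - by move=> z _; apply: sume_ge0 => i _; rewrite lee_fin.
  - apply: emeasurable_sum => i.
    by apply/measurable_EFinP; exact: measurable_indic.
  move=> z _; rewrite sumEFin lee_fin.
  (* The actual transcript depends on [i]; adding the nonnegative terms of all other transcripts
     removes this dependence. *)
  apply: (@le_trans _ _ (\sum_(t : T) \sum_i \1_(A i) (output s t z))%R).
    rewrite exchange_big /=; apply: ler_sum => i _.
    rewrite (bigD1 (transcript s (mu i) z)) //= -[leLHS]addr0.
    by apply: lerD; [rewrite !indicE | rewrite sumr_ge0].
  rewrite (le_trans (ler_sum _ (fun t _ => AK (output s t z))))//.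
  by rewrite sumr_const mulr_natl.
rewrite -lee_fin (le_trans _ sumE)//.
have -> : (#|I|%:R * (1 - delta - eps))%R%:E =
    \sum_(i : I) (1 - delta - eps)%:E.
  by rewrite sumEFin sumr_const mulr_natl.
by apply: lee_sum => i _; exact: PE.
Qed.

End counting.

(** * The one-dimensional weights *)

Section weights.
Import numFieldNormedType.Exports.
Variables (R : realType) (t : R).
Hypotheses (t_gt0 : 0 < t) (t_lt1 : t < 1).

Definition bit_dev (b : bool) : R := if b then 1 else t.

Lemma bit_dev_gt0 b : 0 < bit_dev b.
Proof. by case: b. Qed.

Let g b := normal_pdf 0 (bit_dev b).

Lemma normal_pdf_gt0 (s x : R) : 0 < s -> 0 < normal_pdf 0 s x.
Proof.
move=> s0; rewrite normal_pdfE ?gt_eqF//.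
by rewrite mulr_gt0 ?expR_gt0// normal_peak_gt0// gt_eqF.
Qed.

Lemma normal_peakE (s : R) : 0 < s ->
  normal_peak s = s^-1 * (Num.sqrt (pi *+ 2))^-1.
Proof.
move=> s0; rewrite /normal_peak -mulrnAr sqrtrM ?sqr_ge0//.
by rewrite sqrtr_sqr gtr0_norm// invfM.
Qed.

(** The geometric mean of two centered Gaussian densities is a multiple of a third one, whose
    inverse variance is the average of the two: [s ^+ 2] is the harmonic mean of 1 and [t ^+ 2]. The
    multiple is the total mass [B]. *)
Lemma normal_pdf_overlap : exists (h : R -> R) (B : R),
  [/\ measurable_fun setT h, forall x, 0 < h x,
      forall x, h x ^+ 2 = g true x * g false x,
      (\int[lebesgue_measure]_x (h x)%:E = B%:E)%E & 0 < B < 1].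
Proof.
pose s := Num.sqrt (2 * t ^+ 2 / (1 + t ^+ 2)).
pose B := Num.sqrt (2 * t / (1 + t ^+ 2)).
have D0 : 0 < 1 + t ^+ 2 by rewrite ltr_wpDr// sqr_ge0.
have s2_gt0 : 0 < 2 * t ^+ 2 / (1 + t ^+ 2).
  by rewrite divr_gt0// mulr_gt0// exprn_gt0.
have B2_gt0 : 0 < 2 * t / (1 + t ^+ 2) by rewrite divr_gt0// mulr_gt0.
have s0 : 0 < s by rewrite sqrtr_gt0.
have B0 : 0 < B by rewrite sqrtr_gt0.
have s2 : s ^+ 2 = 2 * t ^+ 2 / (1 + t ^+ 2) by rewrite sqr_sqrtr// ltW.
have B2 : B ^+ 2 = 2 * t / (1 + t ^+ 2) by rewrite sqr_sqrtr// ltW.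
exists (fun x => B * normal_pdf 0 s x), B; split.
- by apply: measurable_funM => //; exact: measurable_normal_pdf.
- by move=> x; rewrite mulr_gt0// normal_pdf_gt0.
- move=> x; rewrite /g !normal_pdfE ?gt_eqF// !normal_peakE//.
  have exp_fun : normal_fun 0 s x ^+ 2 = normal_fun 0 1 x * normal_fun 0 t x.
    rewrite expr2 /normal_fun -!expRD; congr expR.
    by rewrite s2; field; rewrite !gt_eqF.
  have : Num.sqrt (pi *+ 2) != 0 :> R.
    by rewrite gt_eqF// sqrtr_gt0 pmulrn_lgt0// pi_gt0.
  move: (Num.sqrt (pi *+ 2)) => q q0.
  rewrite [LHS](_ : _ = B ^+ 2 / s ^+ 2 * q^-1 ^+ 2 * normal_fun 0 s x ^+ 2).
    by rewrite exp_fun B2 s2 /bit_dev; field; rewrite q0 !gt_eqF.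
  by field; rewrite q0 !gt_eqF.
- under eq_integral do rewrite EFinM.
  rewrite ge0_integralZl//; last 3 first.
  + by apply/measurable_EFinP; exact: measurable_normal_pdf.
  + by move=> x _; rewrite lee_fin normal_pdf_ge0.
  + by rewrite lee_fin ltW.
  by rewrite integral_normal_pdf mule1.
(* [B < 1] amounts to 2t < 1 + t^2, strict because t differs from 1. *)
- rewrite B0/= -sqrtr1 ltr_sqrt// ltr_pdivrMr// mul1r.
  rewrite -subr_gt0 (_ : _ - _ = (1 - t) ^+ 2); last by ring.
  by rewrite exprn_gt0// subr_gt0.
Qed.

(** Since h^2 = g_1 g_0, the ratios g_1 / (g_1 + h) and g_0 / (g_0 + h) sum to 1; scaling them by 2r
    gives the inverse weights. The integrals equal (1 + B) / (2r), which is r exactly when r^2 = (1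
    + B) / 2. *)
Lemma bit_weights : exists (v : bool -> R -> R) (r : R),
  [/\ 0 < r < 1, forall b, measurable_fun setT (v b), forall b x, 0 < v b x,
      forall x, (v true x)^-1 + (v false x)^-1 <= 2 * r &
      forall b, (\int[lebesgue_measure]_x (g b x * v b x)%:E = r%:E)%E].
Proof.
have [h [B [mh h0 h2 hB /andP[B0 B1]]]] := normal_pdf_overlap.
have g0 b x : 0 < g b x by rewrite normal_pdf_gt0// bit_dev_gt0.
pose r := Num.sqrt ((1 + B) / 2).
have r2 : r ^+ 2 = (1 + B) / 2 by rewrite sqr_sqrtr//; lra.
have r0 : 0 < r by rewrite sqrtr_gt0; lra.
have r1 : r < 1 by rewrite -sqrtr1 ltr_sqrt//; lra.
have gv b x : g b x * ((g b x + h x) / (2 * r * g b x)) =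
    (2 * r)^-1 * (g b x + h x).
  by field; rewrite !gt_eqF.
exists (fun b x => (g b x + h x) / (2 * r * g b x)), r; split.
- by rewrite r0.
- move=> b; apply: measurable_funM.
    by apply: measurable_funD => //; exact: measurable_normal_pdf.
  apply: continuous_measurable_fun => x.
  apply: (@continuousV R R (fun y => 2 * r * g b y) x).
    by rewrite gt_eqF// !mulr_gt0.
  apply: continuousM; first exact: cst_continuous.
  by apply: continuous_normal_pdf; rewrite gt_eqF// bit_dev_gt0.
- by move=> b x; rewrite divr_gt0 ?addr_gt0 ?mulr_gt0.
- move=> x; rewrite !invf_div.
  have := h2 x; move: (g0 true x) (g0 false x) (h0 x).
  move: (g true x) (g false x) (h x) => p q z p0 q0 z0 z2.
  rewrite addf_div ?gt_eqF ?addr_gt0// ler_pdivrMr ?mulr_gt0 ?addr_gt0//.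
  rewrite -subr_ge0 (_ : _ - _ = 2 * r * (z ^+ 2 - p * q)); last by ring.
  by rewrite z2 subrr mulr0.
- move=> b; under eq_integral do rewrite gv EFinM EFinD.
  have mgh (f : R -> R) : measurable_fun setT f ->
      measurable_fun [set: measurableTypeR R] (fun x => (f x)%:E).
    by move=> mf; apply/measurable_EFinP.
  rewrite ge0_integralZl//; last 3 first.
  + by apply: emeasurable_funD; apply: mgh => //; exact: measurable_normal_pdf.
  + by move=> x _; rewrite -EFinD lee_fin addr_ge0 ?ltW.
  + by rewrite lee_fin invr_ge0 mulr_ge0// ltW.
  rewrite ge0_integralD//; last 4 first.
  + by move=> x _; rewrite lee_fin ltW.
  + by apply: mgh; exact: measurable_normal_pdf.
  + by move=> x _; rewrite lee_fin ltW.
  + exact: mgh.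
  rewrite hB [X in (X + _)%E]integral_normal_pdf -EFinD -EFinM; congr EFin.
  have -> : 1 + B = 2 * r ^+ 2 by rewrite r2; field.
  by field; rewrite gt_eqF.
Qed.

End weights.

(** * The exponential bound for samplers of the Gaussian class *)

Lemma one_sub_tv_bound (R : realType) (kappa : R) : 1 < kappa ->
  exists2 r : R, 0 < r < 1 & forall (d : nat) (delta : R)
    (dZ : measure_display) (Z : measurableType dZ) (P : probability Z R)
    (T : finType) (s : sampler (@gaussian_class R d kappa) P T),
    (ereal_sup [set tv_dist (output_law s mu) mu
                | mu in @gaussian_class R d kappa] <= delta%:E)%E ->
    1 - delta <= (#|T|%:R + 1) * r ^+ d.
Proof.
move=> kappa1; have kappa0 : 0 < kappa := lt_trans ltr01 kappa1.
(* The two standard deviations 1 and [t] put the variances at the two ends of the allowed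
   interval. *)
pose t := Num.sqrt kappa^-1.
have t0 : 0 < t by rewrite sqrtr_gt0 invr_gt0.
have t1 : t < 1 by rewrite -sqrtr1 ltr_sqrt// invf_lt1.
have t2 : t ^+ 2 = kappa^-1 by rewrite sqr_sqrtr// invr_ge0 ltW.
have [v [r [/andP[r0 r1] mv v0 v_sum gv]]] := bit_weights t0 t1.
(* [r] comes from [t] alone, so it is fixed before the dimension and the sampler. *)
exists r; first by rewrite r0.
move=> d delta dZ Z P T s tvd.
have sd0 (b : {ffun 'I_d -> bool}) i : 0 < bit_dev t (b i).
  exact: bit_dev_gt0.
have /choice[mu muG] : forall b : {ffun 'I_d -> bool},
    exists mu : probability (rspace R d) R,
      is_gaussian (diag_cov (fun i => bit_dev t (b i))) mu.
  by move=> b; exact: is_gaussian_diag_cov (sd0 b).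
have muC b : gaussian_class kappa (mu b).
  apply: (gaussian_class_diag_cov _ (muG b)) => i.
  rewrite /bit_dev; case: ifP => _; first by rewrite expr1n lexx invf_le1// ltW.
  by rewrite t2 lexx invf_le1// ltW.
pose V (b : {ffun 'I_d -> bool}) (x : rspace R d) := \prod_i v (b i) (tnth x i).
have mV b : measurable_fun setT (V b).
  exact: (@measurable_prod_tnth R d (fun i => v (b i))).
have V0 b x : 0 < V b x by apply: prodr_gt0.
pose A b := [set x | V b x <= 1].
have mA b : measurable (A b).
  rewrite -[A b]setTI; apply: measurable_fun_le => //.
have muA b : (mu b (~` A b) <= (r ^+ d)%:E)%E.
  have [m mE] := @lebesgue_rspace_measure R d.
  have {}mE : m = @lebesgue_rspace R d :> (_ -> _) by exact/funext.
  pose g (i : 'I_d) := normal_pdf 0 (bit_dev t (b i)).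
  have mg i : measurable_fun setT (g i) by exact: measurable_normal_pdf.
  have g0 i x : 0 <= g i x by exact: normal_pdf_ge0.
  have mgv i : measurable_fun setT (fun x => g i x * v (b i) x).
    by apply: measurable_funM.
  have gv0 i x : 0 <= g i x * v (b i) x by rewrite mulr_ge0// ltW.
  have mG : measurable_fun [set: rspace R d] (fun x => \prod_i g i (tnth x i)).
    exact: measurable_prod_tnth.
  have mGV : measurable_fun [set: rspace R d]
      (fun x => \prod_i (g i (tnth x i) * v (b i) (tnth x i))).
    exact: measurable_prod_tnth mgv.
  have <- : (\int[@lebesgue_rspace R d]_x
      (\prod_i (g i (tnth x i) * v (b i) (tnth x i)))%:E = (r ^+ d)%:E)%E.
    rewrite (integral_rspace_prod (I := fun=> r) mgv)//.
    - by rewrite prodr_const card_ord.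
    - by move=> i; exact: gv.
  rewrite muG; last exact: measurableC.
  rewrite (_ : gaussian_pdf _ = fun x => \prod_i g i (tnth x i)); last first.
    by apply/funext => x; exact: gaussian_pdf_diag_cov.
  (* Markov by hand: off [A b] the weight exceeds 1, so multiplying the density by it can only
     increase the integral; the domain is then enlarged to the whole space, where the integral is
     [r ^+ d]. *)
  rewrite -mE; apply: (@le_trans _ _ (\int[m]_(x in ~` A b)
      (\prod_i (g i (tnth x i) * v (b i) (tnth x i)))%:E)%E); last first.
    apply: ge0_subset_integral => //; first exact: measurableC.
    - exact/measurable_EFinP.
    - by move=> x _; rewrite lee_fin prodr_ge0.
  apply: ge0_le_integral => //.
  - exact: measurableC.
  - by move=> x _; rewrite lee_fin prodr_ge0.
  - by apply/measurable_EFinP; exact: measurable_funTS.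
  - by apply/measurable_EFinP; exact: measurable_funTS.
  move=> x /= /negP; rewrite -ltNge lee_fin big_split /= => Vx.
  by rewrite ler_peMr ?prodr_ge0// ltW.
have AK x : \sum_b \1_(A b) x <= (2 * r) ^+ d.
  (* The indicator of [V b x <= 1] is at most the inverse of [V b x]. Summed over all words, these
     inverses factor into a product over coordinates of 1 / v_1 + 1 / v_0, each at most [2 * r]. *)
  apply: (@le_trans _ _ (\sum_(b : {ffun 'I_d -> bool})
      \prod_i (v (b i) (tnth x i))^-1)).
    apply: ler_sum => b _; rewrite indicE prodfV.
    have [/set_mem Ax|_] := boolP (x \in A b); last first.
      by rewrite invr_ge0 (ltW (V0 b x)).
    by rewrite invf_ge1 ?(V0 b x).
  rewrite -(bigA_distr_bigA (fun i b => (v b (tnth x i))^-1)) /=.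
  rewrite -[in leRHS](card_ord d) -prodr_const; apply: ler_prod => i _.
  by rewrite big_bool v_sum addr_ge0// invr_ge0 ltW.
have tvdb b : (tv_dist (output_law s (mu b)) (mu b) <= delta%:E)%E.
  by apply: le_trans tvd; apply: ereal_sup_ubound; exists (mu b).
have := sampler_counting_bound muC mA muA AK tvdb.
(* The number of words, 2^d, cancels against the factor 2^d of [(2 * r) ^+ d]. *)
rewrite card_ffun card_bool card_ord natrX exprMn mulrCA.
by rewrite ler_pM2l ?exprn_gt0//; lra.
Qed.

(** * From the exponential bound to a linear number of bits *)

Theorem theorem7 (R : realType) (kappa : R) (kappa_gt1 : 1 < kappa) :
  exists a_kappa c_kappa : R, [/\ 0 < a_kappa, 0 < c_kappa &
    exists d0 : nat, forall d : nat, (d0 <= d)%N ->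
    forall a delta : R, 0 < a -> a <= a_kappa ->
      1 - delta = 2 `^ (- (a * d%:R)) ->
    forall (Q : R) (dZ : measure_display) (Z : measurableType dZ)
      (P : probability Z R) (T : finType)
      (s : sampler (@gaussian_class R d kappa) P T),
      #|T|%:R <= 2 `^ Q ->
      (ereal_sup [set tv_dist (output_law s mu) mu
                  | mu in @gaussian_class R d kappa] <= delta%:E)%E ->
      c_kappa * d%:R <= Q].
Proof.
have [r /andP[r0 r1] bound] := one_sub_tv_bound kappa_gt1.
have ln2 : 0 < ln 2 :> R by rewrite ln_gt0// ltr1n.
have lnr : ln r < 0 by rewrite ln_lt0// r0.
(* Chosen so that r = 2^(-2A): half of the decay absorbs 1 - delta >= 2^(-Ad), and the other half
   forces |T| + 1 >= 2^(Ad). *)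
pose A := - ln r / (2 * ln 2).
have A0 : 0 < A by rewrite divr_gt0 ?oppr_gt0// mulr_gt0.
have rA : r = 2 `^ (- (2 * A)).
  rewrite /powR gt_eqF// -[LHS]lnK ?posrE//; congr expR.
  by rewrite /A; field; rewrite gt_eqF.
(* Halving the exponent again pays for the summand 1 in |T| + 1. *)
exists A, (A / 2); split=> //; first by rewrite divr_gt0.
(* This threshold gives Ad >= 2, hence w = 2^(Ad/2) >= 2. *)
exists (Num.bound (2 / A)) => d dd a delta a0 aA deltaE Q dZ Z P T s TQ tvd.
have Ad : 2 <= A * d%:R.
  rewrite mulrC -ler_pdivrMr//; apply: le_trans (ltW (archi_boundP _)) _.
    by rewrite divr_ge0// ltW.
  by rewrite ler_nat.
have {bound tvd} := bound d delta dZ Z P T s tvd; rewrite deltaE => bound.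
have w2 : 2 <= 2 `^ (A / 2 * d%:R) :> R.
  by rewrite -[leLHS](powRr1 (ler0n _ 2)) ler_powR ?ler1n//; lra.
have TW : 2 `^ (A * d%:R) <= #|T|%:R + 1.
  have u0 : 0 < 2 `^ (A * d%:R) by rewrite powR_gt0.
  have rd : r ^+ d = (2 `^ (A * d%:R))^-1 / 2 `^ (A * d%:R).
    rewrite rA -powR_mulrn ?powR_ge0// -powRrM -invfM -powRD; last first.
      by apply/implyP => _; rewrite pnatr_eq0.
    by rewrite -powRN; congr (_ `^ _); ring.
  have : (2 `^ (A * d%:R))^-1 <= (#|T|%:R + 1) * r ^+ d.
    apply: le_trans bound; rewrite -powRN ler_powR ?ler1n// lerN2.
    by rewrite ler_wpM2r.
  by rewrite rd mulrCA ler_pMr ?invr_gt0// ler_pdivlMr// mul1r.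
(* With w as above, w^2 <= |T| + 1 and w >= 2 give w <= w^2 - 1 <= |T|. *)
have {TW} : 2 `^ (A / 2 * d%:R) <= 2 `^ Q.
  apply: le_trans TQ.
  have : 2 `^ (A * d%:R) = 2 `^ (A / 2 * d%:R) ^+ 2 :> R.
    by rewrite -powR_mulrn ?powR_ge0// -powRrM; congr (_ `^ _); field.
  move: (2 `^ _) w2 TW => w w2; move: (2 `^ _) => u + uE; rewrite uE; nra.
rewrite -[X in is_true X -> _]ler_ln ?posrE ?powR_gt0// !ln_powR.
by rewrite ler_pM2r.
Qed.
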